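(* Let $(G \rightrightarrows M, \pi, N)$ be a Poisson-Nijenhuis groupoid. If $G$ has a P-N action on a Poisson-Nijenhuis manifold $(X, \pi_X, N_X)$ with moment map $J : X \rightarrow M$, then $J$ is a P-N map, where $M$ carries the Poisson-Nijenhuis structure induced from $G$.
   Context: Elements $g,h\in G$ are composable iff $t(g)=s(h)$, and the product is $gh$. $TG\rightrightarrows TM$ is the tangent Lie groupoid. A $(1,1)$-tensor $N:TM\to TM$ is Nijenhuis if $[NX,NY]-N([NX,Y]+[X,NY]-N[X,Y])=0$ for all vector fields $X,Y$. For a bivector field $\pi$, $\pi^\sharp\alpha=\pi(\alpha,-)$ and $[\alpha,\beta]_\pi=\mathcal{L}_{\pi^\sharp\alpha}\beta-\mathcal{L}_{\pi^\sharp\beta}\alpha-d(\pi(\alpha,\beta))$ on 1-forms. A Poisson-Nijenhuis structure on a manifold is a pair $(\pi,N)$ of a Poisson bivector $\pi$ and a Nijenhuis tensor $N$ such that (i) $N\circ\pi^\sharp=\pi^\sharp\circ N^*$ (so $N\circ\pi^\sharp$ defines a bivector $N\pi$), and (ii) $[\alpha,\beta]_{N\pi}=[N^*\alpha,\beta]_\pi+[\alpha,N^*\beta]_\pi-N^*[\alpha,\beta]_\pi$ for all 1-forms $\alpha,\beta$. A smooth map $f:(M,\pi,N)\to(\widetilde M,\widetilde\pi,\widetilde N)$ of Poisson-Nijenhuis manifolds is a P-N map if $f_*\pi=\widetilde\pi$ and $\widetilde N\circ f_*=f_*\circ N$; an anti-P-N map if $f_*\pi=-\widetilde\pi$ and $\widetilde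 N\circ f_*=f_*\circ N$. $(G\rightrightarrows M,\pi)$ is a Poisson groupoid if $\pi$ is Poisson and $\{(g,h,gh): t(g)=s(h)\}$ is coisotropic in $G\times G\times\overline{G}$ ($\overline G$ is $G$ with $-\pi$). A $(1,1)$-tensor $N$ on $G$ is multiplicative if $N:TG\to TG$ is a Lie groupoid morphism over some $N_M:TM\to TM$. A Poisson-Nijenhuis groupoid $(G\rightrightarrows M,\pi,N)$ is a Lie groupoid with a Poisson-Nijenhuis structure $(\pi,N)$ on $G$ such that $(G\rightrightarrows M,\pi)$ is a Poisson groupoid and $N$ is multiplicative. Its base $M$ carries a unique Poisson-Nijenhuis structure $(\pi_M,N_M)$ such that $s$ is a P-N map and $t$ is an anti-P-N map; this is the induced structure. A P-N action of $(G \rightrightarrows M, \pi, N)$ on a Poisson-Nijenhuis manifold $(X,\pi_X,N_X)$ is a Lie groupoid action of $G$ on $X$ with moment map $J:X\to M$ ($gx$ is defined iff $t(g)=J(x)$, and $J(gx)=s(g)$) such that the graph $\Omega=\{(g,x,gx): t(g)=J(x)\}$ is (i) a coisotropic submanifold of $G\times X\times\overline X$ ($\overline X$ is $X$ with $-\pi_X$), and (ii) an invariant submanifold of $G\times X\times X$ with respect to $N\oplus N_X\oplus N_X$, i.e. $(N\oplus N_X\oplus N_X)(T\Omega)\subseteq T\Omega$. *)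

(* Defs.v *)
From HB Require Import structures.
From mathcomp Require Import all_boot all_order all_algebra.
From mathcomp Require Import all_classical all_reals all_analysis.
From mathcomp Require Import ring.

Set Implicit Arguments.
Unset Strict Implicit.
Unset Printing Implicit Defensive.

Import Order.TTheory GRing.Theory Num.Theory.
Import numFieldNormedType.Exports.
Local Open Scope classical_set_scope.
Local Open Scope ring_scope.

Section Euclidean.
Context {R : realType}.

(* C^k on the open set U, in Frechet form: all iterated derivatives of order
   < k in arbitrary directions are (Frechet) differentiable on U, and those of
   order k are continuous on U. *)
Fixpoint Ck (n k : nat) (U : set 'rV[R]_n) (F : 'rV[R]_n -> R) : Prop :=
  if k is k'.+1 then
    (forall x, U x -> differentiable F x) /\
    (forall v, Ck k' U (fun x => 'D_v F x))
  else forall x, U x -> {for x, continuous F}.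

(* F is C^oo on some neighbourhood of x. *)
Definition smooth_near (n : nat) (x : 'rV[R]_n) (F : 'rV[R]_n -> R) : Prop :=
  exists U : set 'rV[R]_n, [/\ open U, U x & forall k, Ck k U F].

Lemma smooth_near_open n (x : 'rV[R]_n) F :
  smooth_near x F -> \forall y \near x, smooth_near y F.
Proof.
move=> [U [oU Ux UF]]; near=> y; exists U; split => //.
by near: y; exact: open_nbhs_nbhs.
Unshelve. all: by end_near. Qed.

Lemma smooth_near_continuous n (x : 'rV[R]_n) F :
  smooth_near x F -> {for x, continuous F}.
Proof. by move=> [U [_ Ux /(_ 0)]]; apply. Qed.

Lemma Ck_cst n k U (a : R) : @Ck n k U (fun=> a).
Proof.
elim: k a => [|k IH] a /=; first by move=> x _; exact: cst_continuous.
split=> [x _|v]; first exact: differentiable_cst.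
have -> : (fun x : 'rV[R]_n => 'D_v (fun=> a) x) = (fun=> 0).
  by apply/funext => x; rewrite derive_cst.
exact: IH.
Qed.

Lemma differentiable_coord1 n (i : 'I_n) (x : 'rV[R]_n) :
  differentiable (fun y : 'rV[R]_n => y 0 i : R) x.
Proof. exact: differentiable_coord. Qed.

Lemma derive_coord n (i : 'I_n) (v x : 'rV[R]_n) :
  'D_v (fun y : 'rV[R]_n => y 0 i : R) x = v 0 i.
Proof.
rewrite deriveE; last exact: differentiable_coord1.
have lin : linear (fun y : 'rV[R]_n => y 0 i : R^o).
  by move=> a u w; rewrite !mxE.
pose c := GRing.isLinear.Build R 'rV[R]_n R^o *:%R
  (fun y : 'rV[R]_n => y 0 i) lin.
pose l : {linear 'rV[R]_n -> R^o} :=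
  HB.pack (fun y : 'rV[R]_n => y 0 i : R^o) c.
have cl : continuous (l : 'rV[R]_n -> R).
  by move=> y; exact: coord_continuous.
by rewrite (_ : (fun y : 'rV[R]_n => y 0 i) = l) // (diff_lin _ cl).
Qed.

Lemma Ck_lincomb n k U (i j : 'I_n) (a b : R) :
  @Ck n k U (fun y => a * y 0 i + b * y 0 j).
Proof.
have dif (x : 'rV[R]_n) (c : R) (l : 'I_n) :
    differentiable (fun y : 'rV[R]_n => c * y 0 l) x.
  exact: differentiableM (differentiable_cst _ _) (differentiable_coord1 _ _).
have difD (x : 'rV[R]_n) :
    differentiable (fun y : 'rV[R]_n => a * y 0 i + b * y 0 j) x.
  exact: differentiableD.
case: k => [|k] /=.
  by move=> x _; exact: differentiable_continuous.
split=> [x _|v]; first exact: difD.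
have -> : (fun x : 'rV[R]_n => 'D_v (fun y : 'rV[R]_n => a * y 0 i + b * y 0 j) x)
    = (fun=> a * v 0 i + b * v 0 j).
  apply/funext => x.
  have drv (c : R) (l : 'I_n) :
      'D_v (fun y : 'rV[R]_n => c * y 0 l) x = c * v 0 l.
    have -> : (fun y : 'rV[R]_n => c * y 0 l) =
        c \*: (fun y : 'rV[R]_n => y 0 l : R) by [].
    rewrite deriveZ ?derive_coord //.
    exact/diff_derivable/differentiable_coord1.
  have := @deriveD R 'rV[R]_n R (fun y : 'rV[R]_n => a * y 0 i)
    (fun y : 'rV[R]_n => b * y 0 j) x v.
  by rewrite !drv; apply; exact/diff_derivable.
exact: Ck_cst.
Qed.

Lemma Ck_mul n k U (i j : 'I_n) : @Ck n k U (fun y => y 0 i * y 0 j).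
Proof.
have dif (x : 'rV[R]_n) :
    differentiable (fun y : 'rV[R]_n => y 0 i * y 0 j) x.
  exact: differentiableM (differentiable_coord1 _ _)
                         (differentiable_coord1 _ _).
case: k => [|k] /=.
  by move=> x _; exact: differentiable_continuous.
split=> [x _|v]; first exact: dif.
have -> : (fun x : 'rV[R]_n => 'D_v (fun y : 'rV[R]_n => y 0 i * y 0 j) x)
    = (fun x => v 0 j * x 0 i + v 0 i * x 0 j).
  apply/funext => x.
  have := @deriveM R 'rV[R]_n (fun y : 'rV[R]_n => y 0 i)
    (fun y : 'rV[R]_n => y 0 j) x v.
  rewrite !derive_coord => ->;
    try exact/diff_derivable/differentiable_coord1.
  by rewrite /GRing.scale /= [v 0 j * _]mulrC [v 0 i * _]mulrC.
exact: Ck_lincomb.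
Qed.

Lemma Ck_smooth_near n (x : 'rV[R]_n) F :
  (forall k, Ck k setT F) -> smooth_near x F.
Proof. by move=> CF; exists setT; split => //; exact: openT. Qed.

End Euclidean.

(* A topological space with a sheaf of continuous real functions closed under
   composition with C^oo functions of finitely many variables (functional
   structures of Bredon, differential spaces of Sikorski).  The sheaf is given
   by its germs: "smooth_at p f" says that f is a section near p; values of f
   away from p are irrelevant.  Manifolds are the spaces of this kind that are
   locally isomorphic to R^n (is_manifold below). *)
Record smooth_space (R : realType) := SmoothSpace {
  pts :> topologicalType;
  smooth_at : pts -> (pts -> R) -> Prop;
  smooth_at_open : forall p f,
    smooth_at p f -> \forall q \near p, smooth_at q f;
  smooth_at_continuous : forall p f, smooth_at p f -> {for p, continuous f};
  smooth_at_comp : forall p n (g : 'I_n -> pts -> R) F h,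
    (forall i, smooth_at p (g i)) ->
    smooth_near (\row_i g i p) F ->
    (\forall q \near p, h q = F (\row_i g i q)) ->
    smooth_at p h }.

(* The smallest smooth structure making the functions in S smooth. *)
Section Generated.
Context {R : realType} {T : topologicalType} (S : T -> (T -> R) -> Prop).

Inductive generated (p : T) : (T -> R) -> Prop :=
| generated_in f : S p f -> generated p f
| generated_comp n (g : 'I_n -> T -> R) F h :
    (forall i, generated p (g i)) ->
    smooth_near (\row_i g i p) F ->
    (\forall q \near p, h q = F (\row_i g i q)) ->
    generated p h.

Hypothesis S_open : forall p f, S p f -> \forall q \near p, S q f.
Hypothesis S_continuous : forall p f, S p f -> {for p, continuous f}.

Lemma continuous_row n (g : 'I_n -> T -> R) p :
  (forall i, {for p, continuous (g i)}) ->
  {for p, continuous (fun q => \row_i g i q)}.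
Proof.
move=> cg A /= [P Pnbhs PA].
have : \forall q \near p, forall j, P 0 j (g j q).
  apply: filter_forall => j; apply: (cg j).
  by have := Pnbhs 0 j; rewrite mxE.
apply: filterS => q Hq; apply: PA => i j.
by rewrite mxE ord1.
Qed.

Lemma generated_continuous p f : generated p f -> {for p, continuous f}.
Proof.
elim=> {f} [f /S_continuous //|n g F h _ cg sF hE].
have hp : h p = F (\row_i g i p) by exact: nbhs_singleton hE.
change (h @ p --> h p); rewrite hp.
apply: cvg_trans (_ : (fun q => F (\row_i g i q)) @ p --> _).
  by apply: near_eq_cvg; near=> q; apply/esym; near: q.
apply: (@continuous_comp T _ _ (fun q => \row_i g i q) F p).
  exact: continuous_row.
exact: smooth_near_continuous.
Unshelve. all: by end_near. Qed.

Lemma generated_open p f : generated p f -> \forall q \near p, generated q f.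
Proof.
elim=> {f} [f /S_open Sf|n g F h gg IH sF hE].
  by apply: filterS Sf => q; exact: generated_in.
have cg : {for p, continuous (fun q => \row_i g i q)}.
  by apply: continuous_row => i; exact: generated_continuous.
have sFq := cg _ (smooth_near_open sF).
have hEq := (nbhs_interior hE).
near=> q.
apply: (@generated_comp q n g F h).
- by near: q; apply: filter_forall.
- by near: q.
- by near: q.
Unshelve. all: by end_near. Qed.

Definition generated_space : smooth_space R :=
  SmoothSpace generated_open generated_continuous generated_comp.

End Generated.

Section Constructions.
Context {R : realType}.
Implicit Types X Y Z : smooth_space R.

(* Product: the structure generated by the smooth functions of each factor. *)
Definition prod_germs X Y (p : X * Y) (f : X * Y -> R) : Prop :=
  (exists2 g, smooth_at p.1 g & f = g \o fst) \/
  (exists2 g, smooth_at p.2 g & f = g \o snd).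

Lemma prod_germs_open X Y p f :
  @prod_germs X Y p f -> \forall q \near p, prod_germs q f.
Proof.
case: p => a b; case=> -[g sg ->].
  have : \forall q \near (a, b), smooth_at q.1 g.
    exact: cvg_fst (smooth_at_open sg).
  by apply: filterS => q sq; left; exists g.
have : \forall q \near (a, b), smooth_at q.2 g.
  exact: cvg_snd (smooth_at_open sg).
by apply: filterS => q sq; right; exists g.
Qed.

Lemma prod_germs_continuous X Y p f :
  @prod_germs X Y p f -> {for p, continuous f}.
Proof.
case: p => a b; case=> -[g /smooth_at_continuous cg ->].
  exact: (@continuous_comp (X * Y)%type X R fst g (a, b) cvg_fst cg).
exact: (@continuous_comp (X * Y)%type Y R snd g (a, b) cvg_snd cg).
Qed.

Definition prod_space X Y : smooth_space R :=
  generated_space (@prod_germs_open X Y) (@prod_germs_continuous X Y).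

(* Subspace: subspace topology, and the functions that locally extend to smooth
   functions of the ambient space. *)
Definition sub_pts X (A : set X) : topologicalType :=
  initial_topology (\val : set_type A -> X).

Definition sub_germs X (A : set X) (p : sub_pts A) (f : sub_pts A -> R) :=
  exists2 g, smooth_at (\val p) g & f = g \o \val.

Lemma sub_germs_open X (A : set X) p f :
  @sub_germs X A p f -> \forall q \near p, sub_germs q f.
Proof.
case=> g sg ->.
have H := @initial_continuous _ _ (\val : set_type A -> X) p _ (smooth_at_open sg).
have : \forall q \near (p : sub_pts A), smooth_at (\val q) g.
  by exact: H.
by apply: filterS => q sq; exists g.
Qed.

Lemma sub_germs_continuous X (A : set X) p f :
  @sub_germs X A p f -> {for p, continuous f}.
Proof.
case=> g /smooth_at_continuous cg ->.
apply: (@continuous_comp (sub_pts A) X R \val g p _ cg).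
exact: (@initial_continuous (set_type A) X \val).
Qed.

Definition sub_space X (A : set X) : smooth_space R :=
  generated_space (@sub_germs_open X A) (@sub_germs_continuous X A).

(* Around p there is a chart phi, with inverse psi, on an open set U, under which
   smooth_at corresponds to being C^oo on R^n. *)
Definition locally_euclidean (n : nat) X : Prop :=
  forall p : X, exists (U : set X) (phi : X -> 'rV[R]_n) (psi : 'rV[R]_n -> X),
    [/\ open U /\ U p, open (phi @` U),
        {in U, cancel phi psi},
        {in U, continuous phi} /\ {in phi @` U, continuous psi} &
        {in U, forall q (f : X -> R),
          smooth_at q f <-> smooth_near (phi q) (f \o psi)}].

Definition is_manifold X : Prop :=
  [/\ hausdorff_space X, @second_countable X &
      exists n, locally_euclidean n X].

Record smooth_map X Y := SmoothMap {
  smap :> X -> Y;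
  smap_continuous : continuous smap;
  smap_smooth : forall p g, smooth_at (smap p) g -> smooth_at p (g \o smap) }.

Definition smooth_fun X (f : X -> R) := forall p, smooth_at p f.

Definition smooth_pred X : {pred (X -> R^o)} := mem [set f | smooth_fun f].

(* The algebra of globally smooth functions. *)
Record Cinf X := MkCinf { cfun :> X -> R^o; cfunP : cfun \in @smooth_pred X }.

HB.instance Definition _ (X : smooth_space R) := [isSub for @cfun X].
HB.instance Definition _ (X : smooth_space R) := [Choice of Cinf X by <:].

Lemma smooth_at_op2 X (p : X) (f g : X -> R) (F : R -> R -> R) :
  smooth_at p f -> smooth_at p g ->
  (forall k, @Ck R 2 k setT (fun x => F (x 0 0) (x 0 1))) ->
  smooth_at p (fun q => F (f q) (g q)).
Proof.
move=> sf sg CF.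
apply: (@smooth_at_comp _ _ p 2 (fun i => if i == 0 then f else g)
          (fun x => F (x 0 0) (x 0 1))).
- by move=> i; case: ifP.
- exact: Ck_smooth_near.
- by near=> q; rewrite !mxE.
Unshelve. all: by end_near. Qed.

Lemma smooth_at_cst X (p : X) (a : R) : smooth_at p (fun=> a).
Proof.
apply: (@smooth_at_comp _ _ p 0 (fun=> fun=> a) (fun=> a)).
- by case.
- by apply: Ck_smooth_near => k; exact: Ck_cst.
- by near=> q.
Unshelve. all: by end_near. Qed.

Lemma smooth_at_lincomb X (p : X) (a b : R) (f g : X -> R) :
  smooth_at p f -> smooth_at p g -> smooth_at p (fun q => a * f q + b * g q).
Proof.
move=> sf sg.
apply: (smooth_at_op2 (F := fun x y => a * x + b * y)) => // k.
exact: Ck_lincomb.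
Qed.

Lemma smooth_at_mul X (p : X) (f g : X -> R) :
  smooth_at p f -> smooth_at p g -> smooth_at p (fun q => f q * g q).
Proof.
move=> sf sg; apply: (smooth_at_op2 (F := fun x y => x * y)) => // k.
exact: Ck_mul.
Qed.

Lemma smooth_subring_closed X : subring_closed (@smooth_pred X).
Proof.
split=> [|f g|f g]; rewrite !inE.
- by move=> p; exact: smooth_at_cst.
- move=> sf sg p.
  have := smooth_at_lincomb 1 (-1) (sf p) (sg p).
  by congr smooth_at; apply/funext => q; rewrite mul1r mulN1r.
- by move=> sf sg p; exact: smooth_at_mul.
Qed.
HB.instance Definition _ X :=
  GRing.isSubringClosed.Build _ (@smooth_pred X) (@smooth_subring_closed X).
HB.instance Definition _ (X : smooth_space R) := 
  GRing.SubChoice_isSubComPzRing.Build (X -> R^o) (@smooth_pred X) (Cinf X)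
    (subringClosedP _).

Lemma smooth_scaler_closed X : GRing.scaler_closed (@smooth_pred X).
Proof.
move=> a f; rewrite !inE => sf p.
have := smooth_at_lincomb a 0 (sf p) (sf p).
by congr smooth_at; apply/funext => q; rewrite mul0r addr0.
Qed.
HB.instance Definition _ X :=
  GRing.isScaleClosed.Build _ _ (@smooth_pred X) (@smooth_scaler_closed X).
HB.instance Definition _ (X : smooth_space R) := [SubZmodule_isSubLmodule of Cinf X by <:].

End Constructions.
Section Tangent.
Context {R : realType}.
Implicit Types X Y Z : smooth_space R.

(* Tangent vectors at p are the derivations of C^oo(X) at p. *)
Definition derivation_pred X (p : X) : {pred (Cinf X -> R^o)} :=
  mem [set v | linear v /\ forall f g : Cinf X, v (f * g) = v f * g p + f p * v g].

Record tangent X (p : X) :=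
  MkTangent { tanf :> Cinf X -> R^o; tanP : tanf \in derivation_pred p }.

HB.instance Definition _ X (p : X) := [isSub for @tanf X p].
HB.instance Definition _ X (p : X) := [Choice of tangent p by <:].

Lemma derivation_submod_closed X (p : X) : submod_closed (derivation_pred p).
Proof.
split=> [|a v w]; rewrite !inE /=.
  by split=> [a f g|f g] /=; rewrite ?scaler0 ?addr0 // mul0r mulr0 addr0.
move=> [lv Dv] [lw Dw]; split=> [b f g|f g].
  rewrite /GRing.add /GRing.scale /= lv lw.
  rewrite /GRing.scale /= !mulrDr !mulrA [b * a]mulrC.
  by rewrite addrACA.
rewrite /GRing.add /GRing.scale /= Dv Dw.
rewrite /GRing.scale /= mulrDl !mulrDr !mulrA [f p * a]mulrC.
by rewrite addrACA.
Qed.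
HB.instance Definition _ X (p : X) :=
  GRing.isSubmodClosed.Build _ _ (derivation_pred p)
    (derivation_submod_closed p).
HB.instance Definition _ X (p : X) := [SubChoice_isSubLmodule of tangent p by <:].

Definition linear_pred (V : lmodType R) : {pred (V -> R^o)} :=
  mem [set a | linear a].

Record cotangent X (p : X) :=
  MkCotangent { cotf :> tangent p -> R^o; cotP : cotf \in @linear_pred (tangent p) }.

HB.instance Definition _ X (p : X) := [isSub for @cotf X p].
HB.instance Definition _ X (p : X) := [Choice of cotangent p by <:].

Lemma linear_submod_closed (V : lmodType R) : submod_closed (@linear_pred V).
Proof.
split=> [|a v w]; rewrite !inE /=.
  by move=> a f g /=; rewrite scaler0 addr0.
move=> lv lw b f g.
rewrite /GRing.add /GRing.scale /= lv lw.
rewrite /GRing.scale /= !mulrDr !mulrA [b * a]mulrC.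
by rewrite addrACA.
Qed.
HB.instance Definition _ (V : lmodType R) :=
  GRing.isSubmodClosed.Build _ _ (@linear_pred V) (@linear_submod_closed V).
HB.instance Definition _ X (p : X) := [SubChoice_isSubLmodule of cotangent p by <:].

Lemma comp_smooth X Y (f : smooth_map X Y) (g : Cinf Y) :
  (g \o f : X -> R^o) \in @smooth_pred R X.
Proof.
rewrite inE => p; apply: smap_smooth.
by have := cfunP g; rewrite inE; apply.
Qed.
Definition pullback_fun X Y (f : smooth_map X Y) (g : Cinf Y) : Cinf X :=
  MkCinf (comp_smooth f g).

Lemma tangent_map_subproof X Y (f : smooth_map X Y) (p : X) (v : tangent p) :
  (fun g => v (pullback_fun f g)) \in derivation_pred (f p).
Proof.
have := tanP v; rewrite !inE => -[lv Dv]; split=> [a g h|g h].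
  by rewrite -lv; congr (tanf v _); exact: val_inj.
by rewrite -[g _]/(pullback_fun f g p) -[h _]/(pullback_fun f h p) -Dv;
  congr (tanf v _); exact: val_inj.
Qed.
Definition tangent_map X Y (f : smooth_map X Y) (p : X) (v : tangent p) :
  tangent (f p) := MkTangent (tangent_map_subproof f v).

Lemma tangent_map_linear X Y (f : smooth_map X Y) (p : X) :
  linear (@tangent_map X Y f p).
Proof. by move=> a v w; apply: val_inj. Qed.

Lemma pull_cov_subproof X Y (f : smooth_map X Y) (p : X)
  (xi : cotangent (f p)) :
  (fun v => xi (tangent_map f v)) \in @linear_pred (tangent p).
Proof.
have := cotP xi; rewrite !inE => lx a v w.
by rewrite -lx tangent_map_linear.
Qed.
Definition pull_cov X Y (f : smooth_map X Y) (p : X) (xi : cotangent (f p)) :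
  cotangent p := MkCotangent (pull_cov_subproof xi).

Lemma dif_subproof X (f : Cinf X) (p : X) :
  (fun v : tangent p => v f) \in @linear_pred (tangent p).
Proof. by rewrite inE. Qed.
Definition dif X (f : Cinf X) (p : X) : cotangent p :=
  MkCotangent (dif_subproof f p).

Definition submersion X Y (f : smooth_map X Y) : Prop :=
  forall (p : X) (w : tangent (f p)), exists v : tangent p, tangent_map f v = w.

Local Notation form2 p := {bilinear (cotangent p) -> (cotangent p) -> R^o}.
Local Notation endo p := {linear (tangent p) -> (tangent p)}.

Lemma difP X (a : R) (f g : Cinf X) (p : X) :
  dif (a *: f + g) p = a *: dif f p + dif g p.
Proof.
apply: val_inj; apply/funext => v /=.
by have := tanP v; rewrite inE => -[lv _]; rewrite lv.
Qed.

Lemma difM X (f g : Cinf X) (p : X) :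
  dif (f * g) p = (g p : R) *: dif f p + (f p : R) *: dif g p.
Proof.
apply: val_inj; apply/funext => v /=.
have := tanP v; rewrite inE => -[_ Dv]; rewrite Dv.
by rewrite mulrC.
Qed.

Lemma sharp_subproof X (p : X) (b : form2 p) (xi : cotangent p) :
  (fun f => b xi (dif f p)) \in derivation_pred p.
Proof.
rewrite inE; split=> [a f g|f g].
  by rewrite difP linearPr.
by rewrite difM linearDr !linearZr_LR /= /GRing.scale /= mulrC.
Qed.
(* pi^# xi = pi(xi, -), as the derivation f |-> pi(xi, d_p f). *)
Definition sharp X (p : X) (b : form2 p) (xi : cotangent p) : tangent p :=
  MkTangent (sharp_subproof b xi).

Lemma transpose_subproof X (p : X) (N : endo p) (xi : cotangent p) :
  (fun v => xi (N v)) \in @linear_pred (tangent p).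
Proof.
have := cotP xi; rewrite !inE => lx a v w.
by rewrite linearP lx.
Qed.
Definition transpose X (p : X) (N : endo p) (xi : cotangent p) : cotangent p :=
  MkCotangent (transpose_subproof N xi).

(* Smoothness of vector fields, 1-forms and tensors is tested on smooth functions,
   vector fields and 1-forms. *)
Record vfield X := MkVfield {
  vf :> forall p : X, tangent p;
  vf_smooth : forall f : Cinf X,
    (fun p => vf p f : R^o) \in @smooth_pred R X }.

Definition vapp X (V : vfield X) (f : Cinf X) : Cinf X := MkCinf (vf_smooth V f).

Lemma bracket_subproof X (V W : vfield X) (p : X) :
  (fun f => V p (vapp W f) - W p (vapp V f)) \in derivation_pred p.
Proof.
have VP (V' : vfield X) a f g :
    vapp V' (a *: f + g) = a *: vapp V' f + vapp V' g.
  apply: val_inj; apply/funext => q /=.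
  by have := tanP (V' q); rewrite inE => -[l _]; rewrite l.
have VM (V' : vfield X) f g :
    vapp V' (f * g) = vapp V' f * g + f * vapp V' g.
  apply: val_inj; apply/funext => q /=.
  by have := tanP (V' q); rewrite inE => -[_ D]; rewrite D.
have := tanP (V p); have := tanP (W p); rewrite !inE => -[lW DW] [lV DV].
have addV (V' : tangent p) : linear V' -> {morph V' : f g / f + g}.
  by move=> l f g; have := l 1 f g; rewrite !scale1r.
split=> [a f g|f g].
  rewrite !VP lV lW scalerBr opprD addrACA //.
rewrite !VM (addV (V p) lV) (addV (W p) lW) !DV !DW /=.
ring.
Qed.
Definition bracket X (V W : vfield X) : forall p : X, tangent p :=
 fun p => MkTangent (bracket_subproof V W p).

Record form1 X := MkForm1 {
  fo :> forall p : X, cotangent p;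
  fo_smooth : forall V : vfield X,
    (fun p => fo p (V p) : R^o) \in @smooth_pred R X }.

Definition fapp X (alpha : form1 X) (V : vfield X) : Cinf X :=
  MkCinf (fo_smooth alpha V).

Lemma dform_subproof X (f : Cinf X) (V : vfield X) :
  (fun p => dif f p (V p) : R^o) \in @smooth_pred R X.
Proof. exact: vf_smooth. Qed.
Definition dform X (f : Cinf X) : form1 X := MkForm1 (dform_subproof f).

(* Smooth sections of the bundle of bilinear forms on T*X; bivector fields are the
   alternating ones. *)
Record tensor20 X := MkTensor20 {
  t20 :> forall p : X, form2 p;
  t20_smooth : forall alpha beta : form1 X,
    (fun p => t20 p (alpha p) (beta p) : R^o) \in @smooth_pred R X }.

Definition t20_app X (pi : tensor20 X) (alpha beta : form1 X) : Cinf X :=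
  MkCinf (t20_smooth pi alpha beta).

Lemma sharp_field_subproof X (pi : tensor20 X) (alpha : form1 X) (f : Cinf X) :
  (fun p => sharp (pi p) (alpha p) f : R^o) \in @smooth_pred R X.
Proof. exact: t20_smooth pi alpha (dform f). Qed.
Definition sharp_field X (pi : tensor20 X) (alpha : form1 X) : vfield X :=
  MkVfield (sharp_field_subproof pi alpha).

Record tensor11 X := MkTensor11 {
  t11 :> forall p : X, endo p;
  t11_smooth : forall (V : vfield X) (f : Cinf X),
    (fun p => t11 p (V p) f : R^o) \in @smooth_pred R X }.

Definition t11_app X (N : tensor11 X) (V : vfield X) : vfield X :=
  MkVfield (t11_smooth N V).

Lemma t11_transpose_subproof X (N : tensor11 X) (alpha : form1 X)
    (V : vfield X) :
  (fun p => transpose (N p) (alpha p) (V p) : R^o) \in @smooth_pred R X.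
Proof. exact: fo_smooth alpha (t11_app N V). Qed.
Definition t11_transpose X (N : tensor11 X) (alpha : form1 X) : form1 X :=
  MkForm1 (t11_transpose_subproof N alpha).

Section ComposeForm.
Context X (p : X) (N : endo p) (b : form2 p).

(* The form b' with b'^# = N o b^#. *)
Definition compose_form (xi eta : cotangent p) : R^o := eta (N (sharp b xi)).

Lemma compose_form_subproof : bilinear_for
  (GRing.Scale.Law.clone _ _ *:%R _) (GRing.Scale.Law.clone _ _ *:%R _)
  compose_form.
Proof.
split=> [eta a xi xi'|xi a eta eta'] //=.
rewrite /compose_form; have := cotP eta; rewrite inE => leta.
rewrite -leta -linearP; congr (cotf eta (N _)).
apply: val_inj; apply/funext => f /=.
by rewrite linearPl.
Qed.
HB.instance Definition _ :=
  bilinear_isBilinear.Build R (cotangent p) (cotangent p) R^o *:%R *:%R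
    compose_form compose_form_subproof.

End ComposeForm.

Lemma compose_t20_subproof X (N : tensor11 X) (pi : tensor20 X)
    (alpha beta : form1 X) :
  (fun p => compose_form (N p) (pi p) (alpha p) (beta p) : R^o)
    \in @smooth_pred R X.
Proof. exact: fo_smooth beta (t11_app N (sharp_field pi alpha)). Qed.
Definition compose_t20 X (N : tensor11 X) (pi : tensor20 X) : tensor20 X :=
  @MkTensor20 X (fun p => compose_form (N p) (pi p))
    (compose_t20_subproof N pi).

(* The value at Z of the 1-form L_V beta. *)
Definition lie_derivative X (V : vfield X) (beta : form1 X) (Z : vfield X)
    (p : X) : R :=
  V p (fapp beta Z) - beta p (bracket V Z p).

(* The value at Z of the 1-form [alpha, beta]_pi. *)
Definition koszul X (pi : tensor20 X) (alpha beta : form1 X) (Z : vfield X)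
    (p : X) : R :=
  lie_derivative (sharp_field pi alpha) beta Z p
  - lie_derivative (sharp_field pi beta) alpha Z p
  - Z p (t20_app pi alpha beta).

Definition nijenhuis X (N : tensor11 X) : Prop :=
  forall (V W : vfield X) (p : X),
    bracket (t11_app N V) (t11_app N W) p
    - N p (bracket (t11_app N V) W p + bracket V (t11_app N W) p
           - N p (bracket V W p)) = 0.

Definition bivector X (pi : tensor20 X) : Prop :=
  forall (p : X) (xi : cotangent p), pi p xi xi = 0.

Definition poisson_bracket X (pi : tensor20 X) (f g : Cinf X) : Cinf X :=
  t20_app pi (dform f) (dform g).

Definition poisson X (pi : tensor20 X) : Prop :=
  bivector pi /\
  forall f g h : Cinf X,
    poisson_bracket pi f (poisson_bracket pi g h)
    + poisson_bracket pi g (poisson_bracket pi h f)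
    + poisson_bracket pi h (poisson_bracket pi f g) = 0.

Definition PN_structure X (pi : tensor20 X) (N : tensor11 X) : Prop :=
  [/\ poisson pi, nijenhuis N,
      forall (p : X) (xi : cotangent p),
        N p (sharp (pi p) xi) = sharp (pi p) (transpose (N p) xi) &
      forall (alpha beta : form1 X) (Z : vfield X) (p : X),
        koszul (compose_t20 N pi) alpha beta Z p =
          koszul pi (t11_transpose N alpha) beta Z p
          + koszul pi alpha (t11_transpose N beta) Z p
          - koszul pi alpha beta (t11_app N Z) p].

(* "f_* pi = pi'" means that pi and pi' are f-related. *)
Definition PN_map X Y (f : smooth_map X Y) (piX : tensor20 X) (NX : tensor11 X)
    (piY : tensor20 Y) (NY : tensor11 Y) : Prop :=
  (forall (p : X) (xi eta : cotangent (f p)),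
     piX p (pull_cov xi) (pull_cov eta) = piY (f p) xi eta) /\
  (forall (p : X) (v : tangent p),
     NY (f p) (tangent_map f v) = tangent_map f (NX p v)).

Definition anti_PN_map X Y (f : smooth_map X Y) (piX : tensor20 X)
    (NX : tensor11 X) (piY : tensor20 Y) (NY : tensor11 Y) : Prop :=
  (forall (p : X) (xi eta : cotangent (f p)),
     piX p (pull_cov xi) (pull_cov eta) = - piY (f p) xi eta) /\
  (forall (p : X) (v : tangent p),
     NY (f p) (tangent_map f v) = tangent_map f (NX p v)).

End Tangent.

Section Products.
Context {R : realType}.
Implicit Types X Y Z : smooth_space R.
Local Notation form2 p := {bilinear (cotangent p) -> (cotangent p) -> R^o}.
Local Notation endo p := {linear (tangent p) -> (tangent p)}.

Lemma fst_smooth X Y (p : prod_space X Y) (g : X -> R) :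
  smooth_at p.1 g -> smooth_at p (g \o fst).
Proof. by move=> sg; apply: generated_in; left; exists g. Qed.
Definition fst_map X Y : smooth_map (prod_space X Y) X :=
  @SmoothMap R (prod_space X Y) X fst (fun=> cvg_fst) (@fst_smooth X Y).

Lemma snd_smooth X Y (p : prod_space X Y) (g : Y -> R) :
  smooth_at p.2 g -> smooth_at p (g \o snd).
Proof. by move=> sg; apply: generated_in; right; exists g. Qed.
Definition snd_map X Y : smooth_map (prod_space X Y) Y :=
  @SmoothMap R (prod_space X Y) Y snd (fun=> cvg_snd) (@snd_smooth X Y).

Lemma generated_pullback (T : topologicalType) (S : T -> (T -> R) -> Prop) X
    (f : X -> T) :
  continuous f ->
  (forall p g, S (f p) g -> smooth_at p (g \o f)) ->
  forall p g, generated S (f p) g -> smooth_at p (g \o f).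
Proof.
move=> cf Sf p g; elim=> {g} [g /Sf //|n g F h _ IH sF hE].
exact: (@smooth_at_comp _ _ p n (fun i => g i \o f) F) IH sF (cf p _ hE).
Qed.

Section Slices.
Context X Y (x : X) (y : Y).

Lemma slice_l_continuous : continuous (fun x' : X => (x', y) : prod_space X Y).
Proof. by move=> x'; apply: cvg_pair; [exact: cvg_id|exact: cvg_cst]. Qed.
Lemma slice_l_smooth (p : X) (g : prod_space X Y -> R) :
  smooth_at ((p, y) : prod_space X Y) g ->
  smooth_at p (g \o (fun x' : X => (x', y))).
Proof.
apply: (generated_pullback slice_l_continuous) => {}p {}g.
by case=> -[h sh ->]; [exact: sh|exact: (smooth_at_cst p (h y))].
Qed.
Definition slice_l : smooth_map X (prod_space X Y) :=
  SmoothMap slice_l_continuous slice_l_smooth.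

Lemma slice_r_continuous : continuous (fun y' : Y => (x, y') : prod_space X Y).
Proof. by move=> y'; apply: cvg_pair; [exact: cvg_cst|exact: cvg_id]. Qed.
Lemma slice_r_smooth (p : Y) (g : prod_space X Y -> R) :
  smooth_at ((x, p) : prod_space X Y) g ->
  smooth_at p (g \o (fun y' : Y => (x, y'))).
Proof.
apply: (generated_pullback slice_r_continuous) => {}p {}g.
by case=> -[h sh ->]; [exact: (smooth_at_cst p (h x))|exact: sh].
Qed.
Definition slice_r : smooth_map Y (prod_space X Y) :=
  SmoothMap slice_r_continuous slice_r_smooth.

Context (bX : form2 x) (bY : form2 y).
Local Notation xy := ((x, y) : prod_space X Y).

Definition pair_form (xi eta : cotangent xy) : R^o :=
  bX (pull_cov (f := slice_l) xi) (pull_cov (f := slice_l) eta)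
  + bY (pull_cov (f := slice_r) xi) (pull_cov (f := slice_r) eta).

Lemma pull_cov_linear X' Y' (f : smooth_map X' Y') (p : X') :
  linear (@pull_cov R X' Y' f p).
Proof. by move=> a v w; apply: val_inj. Qed.

Lemma pair_form_subproof : bilinear_for
  (GRing.Scale.Law.clone _ _ *:%R _) (GRing.Scale.Law.clone _ _ *:%R _)
  pair_form.
Proof.
split=> [eta a xi xi'|xi a eta eta'] /=;
  rewrite /pair_form !pull_cov_linear ?linearPl ?linearPr /=.
  by rewrite scalerDr addrACA.
by rewrite scalerDr addrACA.
Qed.
HB.instance Definition _ :=
  bilinear_isBilinear.Build R (cotangent xy) (cotangent xy) R^o *:%R *:%R
    pair_form pair_form_subproof.

End Slices.

(* piX (+) piY at a point of the product: covectors of the product are restricted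
   to the factors along the slices through that point. *)
Definition sum_form X Y (piX : forall x : X, form2 x)
    (piY : forall y : Y, form2 y) (p : prod_space X Y) : form2 p :=
  match p as p0 return form2 (p0 : prod_space X Y) with
  | (x, y) => pair_form (piX x) (piY y)
  end.

Definition sum_endo X Y (NX : forall x : X, tangent x -> tangent x)
    (NY : forall y : Y, tangent y -> tangent y)
    (p : prod_space X Y) : tangent p -> tangent p :=
  match p as p0
    return tangent (p0 : prod_space X Y) -> tangent (p0 : prod_space X Y) with
  | (x, y) => fun v =>
      tangent_map (slice_l X y) (NX x (tangent_map (fst_map X Y) v))
      + tangent_map (slice_r Y x) (NY y (tangent_map (snd_map X Y) v))
  end.

Section OppForm.
Context X (p : X) (b : form2 p).
Definition opp_form (xi eta : cotangent p) : R^o := - b xi eta.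
Lemma opp_form_subproof : bilinear_for
  (GRing.Scale.Law.clone _ _ *:%R _) (GRing.Scale.Law.clone _ _ *:%R _)
  opp_form.
Proof.
split=> [eta a xi xi'|xi a eta eta'] /=;
  by rewrite /opp_form ?linearPl ?linearPr opprD scalerN.
Qed.
HB.instance Definition _ :=
  bilinear_isBilinear.Build R (cotangent p) (cotangent p) R^o *:%R *:%R
    opp_form opp_form_subproof.
End OppForm.

End Products.

Section Submanifolds.
Context {R : realType}.
Implicit Types X Y Z : smooth_space R.
Local Notation form2 p := {bilinear (cotangent p) -> (cotangent p) -> R^o}.

Section Inclusion.
Context X (A : set X).

Lemma sub_incl_smooth (p : sub_space A) (g : X -> R) :
  smooth_at (\val p) g -> smooth_at p (g \o (\val : set_type A -> X)).
Proof. by move=> sg; apply: generated_in; exists g. Qed.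
Definition sub_incl : smooth_map (sub_space A) X :=
  @SmoothMap R (sub_space A) X (\val : set_type A -> X)
    (@initial_continuous _ _ _) sub_incl_smooth.

Definition sub_point (x : X) (Ax : A x) : sub_space A :=
  exist _ x (mem_set Ax).

(* A is an embedded submanifold when its subspace structure is a manifold; its
   tangent spaces are then the images of the tangent map of the inclusion. *)
Definition submanifold : Prop := is_manifold (sub_space A).

(* b^# maps the annihilator of TA into TA: the vector b(xi, -), as a linear form on
   covectors, is evaluation at a vector tangent to A. *)
Definition coisotropic (b : forall x : X, form2 x) : Prop :=
  submanifold /\
  forall (q : sub_space A) (xi : cotangent (sub_incl q)),
    (forall u : tangent q, xi (tangent_map sub_incl u) = 0) ->
    exists u : tangent q,
      forall eta : cotangent (sub_incl q),
        eta (tangent_map sub_incl u) = b (sub_incl q) xi eta.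

Definition invariant_submanifold (N : forall x : X, tangent x -> tangent x) :
    Prop :=
  submanifold /\
  forall (q : sub_space A) (u : tangent q),
    exists u' : tangent q, tangent_map sub_incl u' = N (sub_incl q) (tangent_map sub_incl u).

End Inclusion.

Section FibreProduct.
Context X Y Z (f : smooth_map X Z) (g : smooth_map Y Z).

Definition fibre_set : set (prod_space X Y) := [set p | f p.1 = g p.2].
Definition fibre_product : smooth_space R := sub_space fibre_set.
Definition fibre_point (x : X) (y : Y) (e : f x = g y) : fibre_product :=
  @sub_point _ fibre_set (x, y) e.

Definition fpr1 (q : fibre_product) : X := fst_map X Y (sub_incl fibre_set q).
Definition fpr2 (q : fibre_product) : Y := snd_map X Y (sub_incl fibre_set q).
Definition tfpr1 (q : fibre_product) (u : tangent q) : tangent (fpr1 q) :=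
  tangent_map (fst_map X Y) (tangent_map (sub_incl fibre_set) u).
Definition tfpr2 (q : fibre_product) (u : tangent q) : tangent (fpr2 q) :=
  tangent_map (snd_map X Y) (tangent_map (sub_incl fibre_set) u).

End FibreProduct.

End Submanifolds.

Section Groupoids.
Context {R : realType}.
Implicit Types X Y Z : smooth_space R.
Local Notation form2 p := {bilinear (cotangent p) -> (cotangent p) -> R^o}.

Record manifold := Manifold {
  mspace :> smooth_space R;
  mspaceP : is_manifold mspace }.

(* g and h are composable iff tgt g = src h. *)
Record lie_groupoid (G M : manifold) := LieGroupoid {
  src : smooth_map G M;
  tgt : smooth_map G M;
  gunit : smooth_map M G;
  ginv : smooth_map G G;
  gmul : smooth_map (fibre_product tgt src) G;
  src_submersion : submersion src;
  tgt_submersion : submersion tgt;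
  src_unit : forall x, src (gunit x) = x;
  tgt_unit : forall x, tgt (gunit x) = x;
  src_mul : forall g h (e : tgt g = src h), src (gmul (fibre_point e)) = src g;
  tgt_mul : forall g h (e : tgt g = src h), tgt (gmul (fibre_point e)) = tgt h;
  mulA : forall g h k (e1 : tgt g = src h) (e2 : tgt h = src k)
      (e12 : tgt (gmul (fibre_point e1)) = src k)
      (e21 : tgt g = src (gmul (fibre_point e2))),
    gmul (fibre_point e12) = gmul (fibre_point e21);
  mul_unitl : forall g (e : tgt (gunit (src g)) = src g),
    gmul (fibre_point e) = g;
  mul_unitr : forall g (e : tgt g = src (gunit (tgt g))),
    gmul (fibre_point e) = g;
  src_inv : forall g, src (ginv g) = tgt g;
  tgt_inv : forall g, tgt (ginv g) = src g;
  mul_invr : forall g (e : tgt g = src (ginv g)),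
    gmul (fibre_point e) = gunit (src g);
  mul_invl : forall g (e : tgt (ginv g) = src g),
    gmul (fibre_point e) = gunit (tgt g) }.

Section Groupoid.
Context (G M : manifold) (Gr : lie_groupoid G M).

Definition mul_graph : set (prod_space (prod_space G G) G) :=
  [set p | exists e : tgt Gr p.1.1 = src Gr p.1.2,
             p.2 = gmul Gr (fibre_point e)].

Definition poisson_groupoid (pi : tensor20 G) : Prop :=
  poisson pi /\
  coisotropic mul_graph
    (sum_form (sum_form (t20 pi) (t20 pi)) (fun g => opp_form (pi g))).

(* N is a groupoid morphism over NM of the tangent groupoid TG => TM.  A
   composable pair (v, w) of TG is (tfpr1 u, tfpr2 u) for a unique tangent vector
   u of the manifold of composable pairs, and v * w is the image of u under the
   tangent map of the multiplication; the last clause says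
   N v * N w = N (v * w). *)
Definition tangent_morphism (N : tensor11 G) (NM : tensor11 M) : Prop :=
  [/\ forall (g : G) (v : tangent g),
        tangent_map (src Gr) (N g v) = NM _ (tangent_map (src Gr) v),
      forall (g : G) (v : tangent g),
        tangent_map (tgt Gr) (N g v) = NM _ (tangent_map (tgt Gr) v),
      forall (x : M) (w : tangent x),
        N _ (tangent_map (gunit Gr) w) = tangent_map (gunit Gr) (NM x w) &
      forall (q : fibre_product (tgt Gr) (src Gr)) (u : tangent q),
        exists u' : tangent q,
          [/\ tfpr1 u' = N _ (tfpr1 u),
              tfpr2 u' = N _ (tfpr2 u) &
              tangent_map (gmul Gr) u' = N _ (tangent_map (gmul Gr) u)]].

Definition multiplicative (N : tensor11 G) : Prop :=
  exists NM : tensor11 M, tangent_morphism N NM.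

Definition PN_groupoid (pi : tensor20 G) (N : tensor11 G) : Prop :=
  [/\ PN_structure pi N, poisson_groupoid pi & multiplicative N].

(* The structure satisfying this is unique since src is a surjective submersion. *)
Definition induced_PN_structure (pi : tensor20 G) (N : tensor11 G)
    (piM : tensor20 M) (NM : tensor11 M) : Prop :=
  [/\ PN_structure piM NM,
      PN_map (src Gr) pi N piM NM &
      anti_PN_map (tgt Gr) pi N piM NM].

Record lie_groupoid_action (X : manifold) (J : smooth_map X M) := LieAction {
  act : smooth_map (fibre_product (tgt Gr) J) X;
  act_moment : forall g x (e : tgt Gr g = J x),
    J (act (fibre_point e)) = src Gr g;
  act_unit : forall x (e : tgt Gr (gunit Gr (J x)) = J x),
    act (fibre_point e) = x;
  act_mul : forall g h x (e : tgt Gr g = src Gr h) (eh : tgt Gr h = J x)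
      (egh : tgt Gr (gmul Gr (fibre_point e)) = J x)
      (eg : tgt Gr g = J (act (fibre_point eh))),
    act (fibre_point egh) = act (fibre_point eg) }.

Definition act_graph (X : manifold) (J : smooth_map X M)
    (a : lie_groupoid_action J) : set (prod_space (prod_space G X) X) :=
  [set p | exists e : tgt Gr p.1.1 = J p.1.2, p.2 = act a (fibre_point e)].

Definition PN_action (pi : tensor20 G) (N : tensor11 G) (X : manifold)
    (piX : tensor20 X) (NX : tensor11 X) (J : smooth_map X M)
    (a : lie_groupoid_action J) : Prop :=
  coisotropic (act_graph a)
    (sum_form (sum_form (t20 pi) (t20 piX)) (fun x => opp_form (piX x))) /\
  invariant_submanifold (act_graph a)
    (sum_endo (sum_endo (fun g => N g) (fun x => NX x)) (fun x => NX x)).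

End Groupoid.
End Groupoids.

Arguments manifold R : clear implicits.

(* Main.v *)
Require Import Defs.
From mathcomp Require Import all_boot all_order all_algebra.
From mathcomp Require Import all_classical all_reals all_analysis.

Set Implicit Arguments.
Unset Strict Implicit.
Unset Printing Implicit Defensive.

(** The source and the moment map are intertwined by the action: s(g) = J(gx),
    so s on the first factor and J on the last factor of G x X x X agree on the
    graph Omega (act_graph_src). Both halves of the theorem come from
    differentiating this identity at the points (1_(J x), x, x) of Omega, which
    exist because units act trivially.

    For the bivectors: dually, for every covector xi of M at J x, the covector
    (s^* xi, 0, - J^* xi) kills T Omega (conormal_moment). On conormal covectors
    of a coisotropic submanifold the bivector vanishes (coisotropic_conormal), so
    pi(s^* xi, s^* eta) - piX(J^* xi, J^* eta) = 0; the two signs of - J^* cancel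
    and the remaining one is that of the opposite bivector on the last factor.
    As s is a P-N map, the first term is piM(xi, eta).

    For the endomorphisms: x |-> (1_(J x), x, x) is a smooth section of
    Omega -> X (unit_section), so each tangent vector v of X at x is the last
    component of some w = (w1, w2, v) tangent to Omega, and J_* v = s_* w1. By
    invariance (N w1, NX w2, NX v) is again tangent to Omega, so
    J_* (NX v) = s_* (N w1) = NM (s_* w1) = NM (J_* v). *)

Import GRing.Theory.
Local Open Scope classical_set_scope.
Local Open Scope ring_scope.

(** * Smooth maps into products and subspaces *)

Section SmoothMaps.
Context {R : realType}.
Implicit Types X Y Z : smooth_space R.

Definition id_map X : smooth_map X X :=
  @SmoothMap R X X id (fun=> cvg_id) (fun _ _ sg => sg).

Lemma comp_map_continuous X Y Z (g : smooth_map Y Z) (f : smooth_map X Y) :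
  continuous (g \o f).
Proof.
by move=> x; apply: (@continuous_comp X Y Z f g x); exact: smap_continuous.
Qed.

Lemma comp_map_smooth X Y Z (g : smooth_map Y Z) (f : smooth_map X Y) p h :
  smooth_at ((g \o f) p) h -> smooth_at p (h \o (g \o f)).
Proof. by move=> /smap_smooth/smap_smooth. Qed.

Definition comp_map X Y Z (g : smooth_map Y Z) (f : smooth_map X Y) :
    smooth_map X Z :=
  @SmoothMap R X Z (g \o f) (@comp_map_continuous X Y Z g f)
    (@comp_map_smooth X Y Z g f).

Section Pairing.
Context X Y Z (f : smooth_map X Y) (g : smooth_map X Z).

Lemma pair_map_continuous :
  continuous (fun x => (f x, g x) : prod_space Y Z).
Proof. by move=> x; apply: cvg_pair; exact: smap_continuous. Qed.

Lemma pair_map_smooth (p : X) (h : prod_space Y Z -> R) :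
  smooth_at ((f p, g p) : prod_space Y Z) h ->
  smooth_at p (h \o (fun x => (f x, g x))).
Proof.
apply: (generated_pullback pair_map_continuous) => {}p {}h.
by case=> -[k sk ->]; [exact: (smap_smooth (s := f) sk)
                     |exact: (smap_smooth (s := g) sk)].
Qed.

Definition pair_map : smooth_map X (prod_space Y Z) :=
  SmoothMap pair_map_continuous pair_map_smooth.

End Pairing.

Section Corestriction.
Context X Y (A : set Y) (f : smooth_map X Y) (fA : forall x, A (f x)).

Lemma corestrict_continuous :
  continuous (fun x => sub_point (fA x) : sub_space A).
Proof.
apply: (@continuous_comp_initial (set_type A) X Y \val).
exact: (smap_continuous (s := f)).
Qed.

Lemma corestrict_smooth (p : X) (h : sub_space A -> R) :
  smooth_at (sub_point (fA p)) h ->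
  smooth_at p (h \o (fun x => sub_point (fA x))).
Proof.
apply: (generated_pullback corestrict_continuous) => {}p {}h.
by case=> k sk ->; exact: (smap_smooth (s := f) sk).
Qed.

Definition corestrict : smooth_map X (sub_space A) :=
  SmoothMap corestrict_continuous corestrict_smooth.

End Corestriction.

End SmoothMaps.

(** * Tangent and cotangent spaces of a product *)

Section TangentMaps.
Context {R : realType}.
Implicit Types X Y Z : smooth_space R.
Local Notation form2 p := {bilinear (cotangent p) -> (cotangent p) -> R^o}.

Lemma tangentP X (p : X) (v w : tangent p) :
  (forall f, v f = w f) -> v = w.
Proof. by move=> vw; apply: val_inj; apply/funext. Qed.

Lemma cotangentP X (p : X) (xi eta : cotangent p) :
  (forall v, xi v = eta v) -> xi = eta.
Proof. by move=> xe; apply: val_inj; apply/funext. Qed.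

Lemma cotangentB X (p : X) (xi : cotangent p) (v w : tangent p) :
  xi (v - w) = xi v - xi w.
Proof.
have := cotP xi; rewrite inE => lx.
by rewrite addrC -scaleN1r lx scaleN1r addrC.
Qed.

Lemma cotangent0 X (p : X) (xi : cotangent p) : xi 0 = 0.
Proof. by rewrite -(subrr 0) cotangentB subrr. Qed.

(** The derivation rule at 1 = 1 * 1 reads v 1 = 2 * v 1, so v kills 1 and with it
    every constant. This is what makes the cross terms between the two factors of
    a product vanish. *)
Lemma tangent_cst X (p : X) (v : tangent p) (f : Cinf X) (c : R) :
  (forall q, f q = c) -> v f = 0.
Proof.
move=> fc; have := tanP v; rewrite inE => -[lv Dv].
have v1 : v 1 = 0.
  have := Dv 1 1; rewrite mulr1 mulr1 mul1r => /eqP.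
  by rewrite -subr_eq subrr eq_sym => /eqP.
have -> : f = c *: (1 : Cinf X) + 0.
  apply: val_inj; apply/funext => q /=.
  by rewrite fc addr0 [RHS]mulr1.
rewrite lv v1 scaler0 add0r.
by have := lv (-1) 0 0; rewrite scaler0 addr0 scaleN1r addrC subrr.
Qed.

Section Product.
Context X Y (x : X) (y : Y).
Local Notation xy := ((x, y) : prod_space X Y).

Lemma fst_slice_l (v : tangent x) :
  tangent_map (fst_map X Y) (tangent_map (slice_l X y) v) = v.
Proof. by apply: tangentP => f; congr (tanf v _); exact: val_inj. Qed.

Lemma snd_slice_r (v : tangent y) :
  tangent_map (snd_map X Y) (tangent_map (slice_r Y x) v) = v.
Proof. by apply: tangentP => f; congr (tanf v _); exact: val_inj. Qed.

Lemma snd_slice_l (v : tangent x) :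
  tangent_map (snd_map X Y) (tangent_map (slice_l X y) v) = 0.
Proof. by apply: tangentP => f; exact: (@tangent_cst _ _ v _ (f y)). Qed.

Lemma fst_slice_r (v : tangent y) :
  tangent_map (fst_map X Y) (tangent_map (slice_r Y x) v) = 0.
Proof. by apply: tangentP => f; exact: (@tangent_cst _ _ v _ (f x)). Qed.

Definition pair_cov (xi : cotangent x) (eta : cotangent y) : cotangent xy :=
  @pull_cov R _ _ (fst_map X Y) xy xi + @pull_cov R _ _ (snd_map X Y) xy eta.

Lemma pair_covE xi eta (v : tangent xy) :
  pair_cov xi eta v =
    xi (tangent_map (fst_map X Y) v) + eta (tangent_map (snd_map X Y) v).
Proof. by []. Qed.

Lemma pull_slice_l xi eta :
  @pull_cov R _ _ (slice_l X y) x (pair_cov xi eta) = xi.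
Proof.
apply: cotangentP => v.
rewrite -[LHS]/(pair_cov xi eta (tangent_map (slice_l X y) v)).
by rewrite pair_covE fst_slice_l snd_slice_l cotangent0 addr0.
Qed.

Lemma pull_slice_r xi eta :
  @pull_cov R _ _ (slice_r Y x) y (pair_cov xi eta) = eta.
Proof.
apply: cotangentP => v.
rewrite -[LHS]/(pair_cov xi eta (tangent_map (slice_r Y x) v)).
by rewrite pair_covE fst_slice_r snd_slice_r cotangent0 add0r.
Qed.

(** In block form the sum of two bivectors is the orthogonal direct sum: pulling a
    block covector back along a slice picks out one block. *)
Lemma sum_form_pair (piX : forall x : X, form2 x) (piY : forall y : Y, form2 y)
    (xi xi' : cotangent x) (eta eta' : cotangent y) :
  sum_form piX piY xy (pair_cov xi eta) (pair_cov xi' eta') =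
    piX x xi xi' + piY y eta eta'.
Proof. by rewrite /= /pair_form !pull_slice_l !pull_slice_r. Qed.

Section Endo.
Variables (NX : forall x : X, tangent x -> tangent x)
  (NY : forall y : Y, tangent y -> tangent y) (v : tangent xy).

Lemma fst_sum_endo :
  tangent_map (fst_map X Y) (sum_endo NX NY v) =
    NX (tangent_map (fst_map X Y) v).
Proof.
rewrite /= -[tangent_map (slice_l X y) _]scale1r tangent_map_linear scale1r.
by rewrite fst_slice_l fst_slice_r addr0.
Qed.

Lemma snd_sum_endo :
  tangent_map (snd_map X Y) (sum_endo NX NY v) =
    NY (tangent_map (snd_map X Y) v).
Proof.
rewrite /= -[tangent_map (slice_l X y) _]scale1r tangent_map_linear scale1r.
by rewrite snd_slice_l snd_slice_r add0r.
Qed.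

End Endo.
End Product.

(** * Points that are only provably equal; conormal covectors *)

(** J x and s(1_(J x)) are equal but not convertible, so a covector of M at one
    of them has to be transported to the other. Tangent vectors need no transport:
    being derivations, they are compared through their values on functions, which
    do not mention the base point. *)
Definition cast_cov X (p q : X) (e : p = q) (xi : cotangent p) : cotangent q :=
  ecast z (cotangent z) e xi.

Lemma cast_covE X (p q : X) (e : p = q) (xi : cotangent p)
    (v : tangent p) (w : tangent q) :
  (forall f, v f = w f) -> cast_cov e xi w = xi v.
Proof. by case: q / e w => w /tangentP ->. Qed.

Lemma t20_cast X (pi : tensor20 X) (p q : X) (e : p = q)
    (xi eta : cotangent p) :
  pi q (cast_cov e xi) (cast_cov e eta) = pi p xi eta.
Proof. by case: q / e. Qed.

Lemma t11_cast X (N : tensor11 X) (p q : X) (e : p = q)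
    (v : tangent p) (w : tangent q) :
  (forall f, v f = w f) -> forall f, N p v f = N q w f.
Proof. by case: q / e w => w /tangentP ->. Qed.

Definition conormal X (A : set X) (q : sub_space A)
    (xi : cotangent (sub_incl A q)) : Prop :=
  forall u : tangent q, xi (tangent_map (sub_incl A) u) = 0.

(** b^# xi is tangent to A, hence killed by the conormal covector eta. *)
Lemma coisotropic_conormal X (A : set X) (b : forall x : X, form2 x)
    (q : sub_space A) (xi eta : cotangent (sub_incl A q)) :
  coisotropic A b -> conormal xi -> conormal eta ->
  b (sub_incl A q) xi eta = 0.
Proof. by move=> [_ cA] /cA[u <-]; apply. Qed.

End TangentMaps.

(** * The graph of a groupoid action *)

Section ActionGraph.
Context {R : realType} (G M : manifold R) (Gr : lie_groupoid G M).
Context (X : manifold R) (J : smooth_map X M) (a : lie_groupoid_action Gr J).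
Local Notation Omega := (act_graph a).

Lemma act_graph_src (p : prod_space (prod_space G X) X) :
  Omega p -> src Gr p.1.1 = J p.2.
Proof. by move=> [e ->]; rewrite act_moment. Qed.

(** The derivative of act_graph_src: for w tangent to the graph, s_* of its first
    component and J_* of its last one are the same derivation. Stating it on
    functions avoids identifying the two base points in M. *)
Lemma tangent_act_graph_src (q : sub_space Omega) (u : tangent q) (f : Cinf M) :
  tangent_map (sub_incl Omega) u
    (pullback_fun (fst_map _ _) (pullback_fun (fst_map _ _)
      (pullback_fun (src Gr) f))) =
  tangent_map (sub_incl Omega) u
    (pullback_fun (snd_map _ _) (pullback_fun J f)).
Proof.
congr (tanf u _); apply: val_inj; apply/funext => r /=.
by congr (f _); exact: act_graph_src (set_mem (valP r)).
Qed.

(** The dual form of s_* w1 = J_* w3; the middle block is 0 because that identity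
    does not involve the second component. *)
Lemma conormal_moment g x y (Oq : Omega ((g, x), y)) (e : J y = src Gr g)
    (xi : cotangent (J y)) :
  @conormal R _ Omega (sub_point Oq)
    (pair_cov (pair_cov (pull_cov (f := src Gr) (cast_cov e xi)) 0)
       (- pull_cov (f := J) xi)).
Proof.
move=> u; set w := tangent_map _ _.
rewrite pair_covE pair_covE addr0.
apply/eqP; rewrite subr_eq0; apply/eqP.
apply: cast_covE => f; apply/esym; exact: tangent_act_graph_src.
Qed.

(** These points lie over every x in X and have moment J x = s(1_(J x)), so what is
    proved along them covers all of X. *)
Lemma unit_in_act_graph (x : X) : Omega ((gunit Gr (J x), x), x).
Proof. by exists (tgt_unit Gr (J x)); rewrite act_unit. Qed.

(** Its tangent map lifts every tangent vector of X to one of the graph. *)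
Definition unit_section : smooth_map X (sub_space Omega) :=
  @corestrict R X _ Omega
    (pair_map (pair_map (comp_map (gunit Gr) J) (id_map X)) (id_map X))
    unit_in_act_graph.

End ActionGraph.

Theorem proposition9p3 (R : realType) (G M : manifold R)
    (Gr : lie_groupoid G M) (pi : tensor20 G) (N : tensor11 G)
    (hG : PN_groupoid Gr pi N)
    (piM : tensor20 M) (NM : tensor11 M)
    (hM : induced_PN_structure Gr pi N piM NM)
    (X : manifold R) (piX : tensor20 X) (NX : tensor11 X)
    (hX : PN_structure piX NX)
    (J : smooth_map X M) (a : lie_groupoid_action Gr J)
    (ha : PN_action pi N piX NX a) :
  PN_map J piX NX piM NM.
Proof.
case: hM => _ [src_pi src_N] _; case: ha => coisoO [_ invO].
split=> x.
- move=> xi eta.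
  have e : J x = src Gr (gunit Gr (J x)) by rewrite src_unit.
  have cn zeta := conormal_moment (Oq := unit_in_act_graph a x) e zeta.
  have := coisotropic_conormal coisoO (cn xi) (cn eta).
  rewrite [X in X = _]sum_form_pair sum_form_pair linear0r addr0 src_pi t20_cast.
  rewrite /= /opp_form linearNl linearNr opprK => /eqP.
  by rewrite subr_eq0 => /eqP.
- (* u lifts v to the graph, and u' is its image under the sum of N, NX and NX. *)
  move=> v; set u := tangent_map (unit_section a) v.
  have uE : tangent_map (snd_map _ _) (tangent_map (sub_incl (act_graph a)) u)
      = v.
    by apply: tangentP => f; congr (tanf v _); exact: val_inj.
  have [u' u'E] := invO _ u.
  have u'1 : tangent_map (fst_map _ _) (tangent_map (fst_map _ _)
        (tangent_map (sub_incl (act_graph a)) u')) =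
      N _ (tangent_map (fst_map _ _) (tangent_map (fst_map _ _)
        (tangent_map (sub_incl (act_graph a)) u))).
    by rewrite u'E [X in tangent_map _ X = _]fst_sum_endo [LHS]fst_sum_endo.
  have u'2 : tangent_map (snd_map _ _) (tangent_map (sub_incl (act_graph a)) u')
      = NX x v.
    by rewrite u'E [LHS]snd_sum_endo uE.
  apply: tangentP => f.
  transitivity (tangent_map (src Gr) (tangent_map (fst_map _ _)
    (tangent_map (fst_map _ _) (tangent_map (sub_incl (act_graph a)) u'))) f).
    rewrite u'1 -src_N; apply: t11_cast => [|h]; first by rewrite src_unit.
    by rewrite -[LHS]/(v (pullback_fun J h)) -uE -[LHS]tangent_act_graph_src.
  by rewrite -[RHS]/(NX x v (pullback_fun J f)) -u'2 -[RHS]tangent_act_graph_src.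
Qed.
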